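(* For every $FU$-filter $\mathcal{F}$ on $\omega$ there is a family $\{\mathcal{F}_\alpha:\alpha<\mathfrak{c}^+\}$ of $FU$-filters on $\omega$ such that $\mathcal{F}\leq_{RK}\mathcal{F}_\alpha$ for every $\alpha<\mathfrak{c}^+$, and $\mathcal{F}_\alpha<_{RK}\mathcal{F}_\beta$ whenever $\alpha<\beta<\mathfrak{c}^+$.
   Context: All filters are proper free filters on $\omega$ (they contain all cofinite sets). $A\subseteq^* B$ means $A\setminus B$ is finite. A filter $\mathcal{F}$ is an $FU$-filter (Fréchet-Urysohn filter) if for every $A\subseteq\omega$ meeting every element of $\mathcal{F}$ there is an infinite $S\subseteq A$ with $S\subseteq^* F$ for all $F\in\mathcal{F}$. For $f:\omega\to\omega$, $f[\mathcal{G}]=\{X\subseteq\omega:f^{-1}(X)\in\mathcal{G}\}$. $\mathcal{F}\leq_{RK}\mathcal{G}$ means there is a surjection $f:\omega\to\omega$ with $f[\mathcal{G}]=\mathcal{F}$. $\mathcal{F}\approx\mathcal{G}$ means there is a bijection $f:\omega\to\omega$ with $f[\mathcal{F}]=\mathcal{G}$. $\mathcal{F}<_{RK}\mathcal{G}$ means $\mathcal{F}\leq_{RK}\mathcal{G}$ and $\mathcal{F}\not\approx\mathcal{G}$. $\mathfrak{c}^+$ is the successor cardinal of $\mathfrak{c}=2^{\aleph_0}$. *)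

(* Defs.v *)
From HB Require Import structures.
From mathcomp Require Import all_boot all_order.
From mathcomp Require Import wochoice all_classical.

Set Implicit Arguments.
Unset Strict Implicit.
Unset Printing Implicit Defensive.

Local Open Scope classical_set_scope.
Local Open Scope card_scope.

Definition almost_subset (A B : set nat) : Prop := finite_set (A `\` B).

Definition free_filter (F : set_system nat) : Prop :=
  ProperFilter F /\ forall A : set nat, finite_set (~` A) -> F A.

Definition FU_filter (F : set_system nat) : Prop :=
  free_filter F /\
  forall A : set nat, (forall X, F X -> A `&` X !=set0) ->
    exists S : set nat, [/\ infinite_set S, S `<=` A &
      forall X, F X -> almost_subset S X].

(* [fmap f G] is the set of all [X] such that [f @^-1` X] is in [G]. *)
Definition RK_le (F G : set_system nat) : Prop :=
  exists f : nat -> nat,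
    set_surj [set: nat] [set: nat] f /\ fmap f G = F.

Definition RK_iso (F G : set_system nat) : Prop :=
  exists f : nat -> nat,
    set_bij [set: nat] [set: nat] f /\ fmap f F = G.

Definition RK_lt (F G : set_system nat) : Prop :=
  RK_le F G /\ ~ RK_iso F G.

(* [W] has the order type of the initial ordinal c^+: it is well ordered, it
   has more than c elements, and each of its proper initial segments has at
   most c elements.  Up to isomorphism there is exactly one such order; one is
   constructed in [continuum_succ_order_exists]. *)
Definition continuum_succ_order (d : Order.disp_t) (W : orderType d) : Prop :=
  [/\ well_order (<=%O : rel W),
      ~~ ([set: W] #<= [set: set nat]) &
      forall b : W, [set a : W | (a < b)%O] #<= [set: set nat]].

Lemma well_order_orderType (T : choiceType) (R : rel T) : well_order R ->
  exists (d : Order.disp_t) (W : orderType d) (f : W -> T),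
    bijective f /\ forall a b : W, (a <= b)%O = R (f a) (f b).
Proof.
case: T R => T [cm em]; set C := Choice.Pack _ => R wo.
have woc : wo_chain R predT by move=> A _; apply: wo.
have Rrefl : reflexive R.
  by move=> x; apply: (wo_chain_reflexive woc).
have Ranti : antisymmetric R.
  by move=> x y; apply: (wo_chain_antisymmetric woc).
have Rtot : total R by move=> x y; apply: (wo_chainW woc).
have Rtrans : transitive R.
  move=> y x z Rxy Ryz.
  have [|m [[mA mlb] _]] := wo [pred u | (u == x) || (u == y) || (u == z)].
    by exists x; rewrite inE eqxx.
  have Rmx : R m x by apply: mlb; rewrite inE eqxx.
  have Rmy : R m y by apply: mlb; rewrite inE eqxx orbT.
  have Rmz : R m z by apply: mlb; rewrite inE eqxx !orbT.
  case/orP: mA => [/orP[]|] /eqP E; subst m => //.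
    by have -> : x = y by apply: Ranti; rewrite Rxy.
  by have <- : y = z by apply: Ranti; rewrite Ryz.
pose m := Order.Le_isPOrder.Build (Order.Disp tt tt) C Rrefl Ranti Rtrans.
pose P : porderType (Order.Disp tt tt) := HB.pack (Choice.sort C) m.
pose tot := Order.POrder_isTotal.Build (Order.Disp tt tt) P Rtot.
pose W : orderType (Order.Disp tt tt) := HB.pack T P tot.
exists (Order.Disp tt tt), W, id; split=> //.
by exists id.
Qed.

Lemma continuum_succ_order_exists :
  exists (d : Order.disp_t) (W : orderType d), continuum_succ_order W.
Proof.
have [R wo] := well_ordering_principle (set (set nat)).
have [d [T [f [[g fK gK] fR]]]] := @well_order_orderType (set (set nat)) R wo.
have woT : well_order (<=%O : rel T).
  apply: antisymmetric_well_order; first exact: Order.POrderTheory.le_anti.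
  move=> A [x Ax].
  have [|z [[zA zlb] _]] := wo [pred u | g u \in A].
    by exists (f x); rewrite inE fK.
  exists (g z); split=> // y yA; rewrite fR gK; apply: zlb.
  by rewrite inE fK.
pose small : pred T := fun x => [set y : T | (y < x)%O] #<= [set: set nat].
pose S : choiceType := {x : T | small x}.
have woS : well_order (fun x y : S => (val x <= val y)%O).
  apply: antisymmetric_well_order.
    by move=> x y /Order.POrderTheory.le_anti/val_inj.
  move=> A [x Ax].
  have [|z [[/asboolP[w [zw wA]] zlb] _]] :=
      woT (fun t => `[< exists w : S, val w = t /\ w \in A >]).
    by exists (val x); apply/asboolP; exists x.
  exists w; split=> // y yA; rewrite zw; apply: zlb.
  by apply/asboolP; exists y.
have [d' [W [h [[k hK kK] hR]]]] := well_order_orderType woS.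
have hlt (a b : W) : (a < b)%O = (val (h a) < val (h b))%O.
  rewrite !Order.POrderTheory.lt_neqAle hR; congr (~~ _ && _).
  by rewrite (inj_eq val_inj) (inj_eq (can_inj hK)).
have inj_vh : injective (fun a : W => val (h a)).
  by move=> a b /val_inj /(can_inj hK).
exists d', W; split.
- apply: antisymmetric_well_order; first exact: Order.POrderTheory.le_anti.
  move=> A [x Ax].
  have [|z [[zA zlb] _]] := woS [pred u | k u \in A].
    by exists (h x); rewrite inE hK.
  exists (k z); split=> // y yA; rewrite hR kK; apply: zlb.
  by rewrite inE hK.
- apply/negP => Wle.
  have imW : [set t : T | small t] #<= [set: set nat].
    apply: card_le_trans Wle.
    have -> : [set t : T | small t] = (fun a : W => val (h a)) @` [set: W].
      apply/seteqP; split=> [t st|_ [w _ <-]]; last exact: (valP (h w)).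
      by exists (k (exist _ t st)) => //; rewrite kK.
    exact: card_image_le.
  have [|z [[zns zlb] _]] := woT [pred t | ~~ small t].
    apply: contrapT => nall.
    have all_small (t : T) : small t.
      by apply: contrapT => /negP nt; apply: nall; exists t.
    have {}imW : [set: set (set nat)] #<= [set: set nat].
      apply: card_le_trans imW.
      have -> : [set t : T | small t] = [set: T].
        by apply/seteqP; split=> // t _; exact: all_small.
      rewrite (_ : [set: set (set nat)] = f @` [set: T]) ?card_image_le//.
      by apply/seteqP; split=> // t _; exists (g t); rewrite ?gK.
    have [i i_inj] := pcard_injP imW.
    have iinj : injective i.
      by move=> x y; apply: i_inj; rewrite in_setT.
    pose D : set (set nat) := [set s | exists X, i X = s /\ ~ X s].
    have nD : ~ D (i D).
      by move=> [X [/iinj XD]]; rewrite XD => nD; apply: (nD); exists D.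
    by apply: (nD); exists D.
  move/negP: zns; apply.
  apply: card_le_trans imW; apply: subset_card_le => y /= yz.
  apply: contrapT => /negP yns.
  by have := zlb y yns; rewrite Order.TotalTheory.leNgt yz.
- move=> b; apply: card_le_trans (valP (h b)).
  have inj_seg : {in [set a : W | (a < b)%O] &,
      injective (fun a : W => val (h a))}.
    by move=> x y _ _; exact: inj_vh.
  rewrite -(card_le_eql (inj_card_eq inj_seg)).
  by apply: subset_card_le => _ [a /= ab <-]; rewrite /= -hlt.
Qed.

(* Main.v *)
(* The FU-filters are exactly the filters of all sets that almost contain each
   member of a nonempty family of injective sequences.  Hence continuum many
   FU-filters [G x] have an FU upper bound: on the countable set of pairs
   (finite sequence, number) take for every branch [y] and every sequence [t]
   converging to [G y] the sequence k |-> (y restricted to k, t k).  The map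
   [f x] that reads the second coordinate along the branch [x], and follows a
   fixed sequence converging to [G x] off that branch, sends this filter to
   [G x].  A diagonal argument over all maps [nat -> nat] yields an FU-filter
   not below a given filter, so the upper bound can be made strict, and the
   chain is built by well-founded recursion. *)
Require Import Defs.
From mathcomp Require Import all_boot all_order.
From mathcomp Require Import wochoice all_classical.

Set Implicit Arguments.
Unset Strict Implicit.
Unset Printing Implicit Defensive.

Local Open Scope classical_set_scope.
Local Open Scope card_scope.

(** * Filters and convergent sequences *)

Definition limit_filter (P : set (nat -> nat)) : set_system nat :=
  \bigcap_(s in P) fmap s \oo.

Lemma injective_eventually_notin (s : nat -> nat) (B : set nat) :
  injective s -> finite_set B -> \oo [set k | ~ B (s k)].
Proof.
move=> s_inj fB.
have /finite_seqP[r rB] : finite_set (s @^-1` B).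
  by apply: finite_preimage fB => x y _ _; exact: s_inj.
exists (\max_(i <- r) i).+1 => //= k rk Bk.
have kr : k \in r by have : (s @^-1` B) k by []; rewrite rB.
by have := leq_bigmax_seq (F := id) k kr isT; rewrite leqNgt /= rk.
Qed.

Lemma eventually_finite_setC (P : set nat) : \oo P -> finite_set (~` P).
Proof.
move=> [N _ NP]; apply: sub_finite_set (finite_II N) => k /= nPk.
by rewrite ltnNge; apply/negP => /NP.
Qed.

(** If [A] meets every member, its complement is not a member, so some [s] in [P] visits [A]
    infinitely often; the part of its range inside [A] is the required set. *)
Lemma limit_filter_FU (P : set (nat -> nat)) :
  P !=set0 -> (forall s, P s -> injective s) -> FU_filter (limit_filter P).
Proof.
move=> [s0 Ps0] Pinj.
have FP : ProperFilter (limit_filter P).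
  split; first by move=> /(_ s0 Ps0)/= /filter_ex[].
  split=> [s _ /=|A B FA FB s Ps /=|A B AB FA s Ps /=].
  - exact: filterT.
  - by have /= FAs := FA s Ps; have /= := FB s Ps; exact: filterI.
  - by have /= := FA s Ps; apply: filterS => k; exact: AB.
split; first split=> // A fA s Ps.
  by apply: filterS (injective_eventually_notin (Pinj s Ps) fA) => k /contrapT.
move=> A Apos.
have [s Ps nA] : exists2 s, P s & ~ \oo [set k | ~ A (s k)].
  apply: contrapT => ns; have [|x []//] := Apos (~` A).
  by move=> s Ps; apply: contrapT => nA; apply: ns; exists s.
exists (A `&` range s); split=> [fS||X FX]; last 2 first.
- by move=> x [].
- apply: sub_finite_set (finite_image s (eventually_finite_setC (FX s Ps))).
  by move=> _ [[_ [k _ <-]] nX]; exists k.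
apply: nA; apply: filterS (injective_eventually_notin (Pinj s Ps) fS).
by move=> k nS Ak; apply: nS; split=> //; exists k.
Qed.

(** The complement of [X] meets every member of [F], so it contains an infinite set converging to
    [F], through which [t] runs injectively. Hence the sequences converging to [F] determine it. *)
Lemma FU_filter_escaping_seq (F : set_system nat) (X : set nat) :
    FU_filter F -> ~ F X ->
  exists t, [/\ injective t, forall k, ~ X (t k) & F `<=` fmap t \oo].
Proof.
move=> [[FF _] FU] nFX; have [|S [infS SX cS]] := FU (~` X).
  move=> Y FY; apply: contrapT => nXY; apply: nFX; apply: filterS FY => y Yy.
  by apply: contrapT => nXy; apply: nXY; exists y.
have /infiniteP/pcard_leP[t] := infS.
have t_inj : injective t by move=> k l; apply: inj; rewrite inE.
have tS k : S (t k) by exact: funS.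
exists t; split=> [//|k|Y FY]; first exact/SX/tS.
apply: filterS (injective_eventually_notin t_inj (cS Y FY)) => k nSY.
by apply: contrapT => nY; apply: nSY.
Qed.

(** * The Rudin-Keisler order and upper bounds *)

Lemma RK_le_trans (F G H : set_system nat) :
  RK_le F G -> RK_le G H -> RK_le F H.
Proof.
move=> [f [sf <-]] [g [sg <-]]; exists (f \o g); split=> //.
by move=> x _; have [y _ <-] := sf x I; have [z _ <-] := sg y I; exists z.
Qed.

Lemma RK_iso_le (F G : set_system nat) : RK_iso F G -> RK_le G F.
Proof. by move=> [f [[_ _ sf] fF]]; exists f. Qed.

Lemma eventually_mkseq_neq (u v : nat -> nat) :
  u <> v -> \oo [set k | mkseq u k <> mkseq v k].
Proof.
move=> uv; have [n un] : exists n, u n <> v n.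
  by apply: contrapT => nuv; apply: uv; apply/funext => n;
    apply: contrapT => ?; apply: nuv; exists n.
exists n.+1 => //= k nk /(congr1 (nth 0 ^~ n)).
by rewrite !nth_mkseq.
Qed.

Lemma FU_upper_bound (G : (nat -> nat) -> set_system nat) :
    (forall x, FU_filter (G x)) ->
  exists H, FU_filter H /\ forall x, RK_le (G x) H.
Proof.
move=> GFU.
have /choice[e eP] x : exists t, injective t /\ G x `<=` fmap t \oo.
  have nG0 : ~ G x set0 by have [[? _] _] := GFU x; exact: filter_not_empty.
  by have [t [? _ ?]] := FU_filter_escaping_seq (GFU x) nG0; exists t.
pose P : set (nat -> nat) := [set s | exists y t,
  [/\ injective t, G y `<=` fmap t \oo &
      s = fun k => pickle (mkseq y k, t k)]].
exists (limit_filter P); split.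
  apply: limit_filter_FU => [|s [y [t [_ _ ->]]] k l].
    pose y0 := id : nat -> nat; have [? ?] := eP y0.
    by exists (fun k => pickle (mkseq y0 k, e y0 k)), y0, (e y0).
  move=> /(pcan_inj pickleK)[+ _].
  by move=> /(congr1 size); rewrite !size_mkseq.
move=> x.
(* The default 0 is harmless: sequences in [P] take only codes of pairs as values. *)
pose f n := if unpickle n is Some (z, m) then
  if z == mkseq x (size z) then m else e x (size z) else 0.
have fE y m k : f (pickle (mkseq y k, m)) =
    if mkseq y k == mkseq x k then m else e x k.
  by rewrite /f pickleK size_mkseq.
exists f; split.
  (* The empty sequence is on every branch, so [f] already takes every value there. *)
  by move=> m _; exists (pickle (mkseq x 0, m)) => //; rewrite fE eqxx.
apply/seteqP; split=> X /=.
  apply: contraPP => nGX HX.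
  have [t [t_inj tX tG]] := FU_filter_escaping_seq (GFU x) nGX.
  have /= Xs : fmap (fun k => pickle (mkseq x k, t k)) \oo (f @^-1` X).
    by apply: HX; exists x, t.
  have [k /=] := filter_ex Xs.
  by rewrite fE eqxx => /tX.
move=> GX s [y [t [t_inj tG ->]]] /=.
have [yx|xy] := pselect (y = x).
  by subst y; have /= := tG X GX; apply: filterS => k /=; rewrite fE eqxx.
have [_ /(_ X GX) /= Xe] := eP x.
apply: filterS2 (eventually_mkseq_neq xy) Xe => k /= /eqP neq.
by rewrite fE (negPf neq).
Qed.

(* The branches [s u] form an almost disjoint family indexed by the candidate
   maps [u] themselves; whether [s u] converges to [K] is chosen so that [u]
   does not map [H] to [K]. *)
Lemma FU_not_RK_le (H : set_system nat) :
  exists K, FU_filter K /\ ~ RK_le K H.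
Proof.
pose s (u : nat -> nat) k := pickle (mkseq u k).
have s_inj u : injective (s u).
  by move=> k l /(pcan_inj pickleK)/(congr1 size); rewrite !size_mkseq.
pose D : set (nat -> nat) := [set u | set_surj setT setT u ->
  fmap u H (~` range (s u))].
exists (limit_filter (s @` D)); split.
  apply: limit_filter_FU => [|_ [u _ <-]//].
  (* A constant map is not onto, so it lies in [D] vacuously. *)
  by exists (s (fun=> 0)), (fun=> 0) => // /(_ 1 I)[].
move=> [u [su Ku]].
have Du : ~ D u.
  move=> Du; have := Du su; rewrite Ku.
  move=> /(_ (s u)) /(_ (imageP _ Du)) /= /filter_ex[k]; apply.
  by exists k.
(* Each [v] in [D] differs from [u], so [s v] eventually leaves the range of [s u]; the complement
   of that range is then in the filter, which puts [u] in [D]. *)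
apply: (Du) => _; rewrite Ku => _ [v Dv <-] /=.
have uv : u <> v by move=> uv; apply: Du; rewrite uv.
apply: filterS (eventually_mkseq_neq uv) => k neq [l _].
move=> /(pcan_inj pickleK) E; apply: neq.
have kl : l = k by move/(congr1 size): E; rewrite !size_mkseq.
by rewrite -E kl.
Qed.

Lemma FU_upper_bound2 (F G : set_system nat) : FU_filter F -> FU_filter G ->
  exists H, [/\ FU_filter H, RK_le F H & RK_le G H].
Proof.
move=> FF FG.
have [|H [FH GH]] := @FU_upper_bound (fun x => if x 0 == 0 then F else G).
  by move=> x; case: ifP.
by exists H; split; [|exact: (GH (fun=> 0))|exact: (GH (fun=> 1))].
Qed.

Lemma FU_strict_upper_bound {I : Type} (A : set I) (G : I -> set_system nat)
    (F : set_system nat) : A #<= [set: set nat] ->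
    FU_filter F -> (forall i, A i -> FU_filter (G i)) ->
  exists H, [/\ FU_filter H, RK_le F H & forall i, A i -> RK_lt (G i) H].
Proof.
move=> /pcard_injP[j j_inj] FF GF.
pose c i : nat -> nat := fun n => `[< j i n >].
have c_inj : {in A &, injective c}.
  move=> a b aA bA cab; apply: j_inj => //; apply/funext => n; apply/propext.
  have := congr1 (@^~ n) cab; rewrite /c.
  by do 2![case: asboolP].
(* Indices are coded by characteristic functions; points that code no index of [A] receive [F]. *)
pose G' (x : nat -> nat) : set_system nat :=
  if pselect (exists2 i, A i & c i = x) is left ex
  then G (projT1 (cid2 ex)) else F.
have G'c i : A i -> G' (c i) = G i.
  rewrite /G'; case: pselect => [ex|nex] Ai; last by case: nex; exists i.
  by case: cid2 => k Ak /= /c_inj->//; rewrite inE.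
have [|H1 [FH1 GH1]] := @FU_upper_bound G'.
  move=> x; rewrite /G'; case: pselect => // ex.
  by case: cid2 => k Ak /= _; exact: GF.
have [K [FK KH1]] := FU_not_RK_le H1.
have [H2 [FH2 H12 KH2]] := FU_upper_bound2 FH1 FK.
have [H [FH FleH H2H]] := FU_upper_bound2 FF FH2.
exists H; split=> // i Ai.
have GiH1 : RK_le (G i) H1 by rewrite -(G'c i Ai).
split; first exact: RK_le_trans GiH1 (RK_le_trans H12 H2H).
(* If [H] were isomorphic to [G i], then [K], being below [H], would be below [H1]. *)
move=> /RK_iso_le HG; apply: KH1.
exact: RK_le_trans KH2 (RK_le_trans H2H (RK_le_trans HG GiH1)).
Qed.

(** * Recursion along the well-order *)

Lemma well_order_well_founded (d : Order.disp_t) (W : orderType d) :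
  well_order (<=%O : rel W) -> well_founded (fun a b : W => (a < b)%O).
Proof.
move=> wo b; apply: contrapT => nb.
have [|m [[/asboolP nm mle] _]] :=
  wo (fun a => `[< ~ Acc (fun a b : W => (a < b)%O) a >]).
  by exists b; apply/asboolP.
apply: nm; constructor => a am; apply: contrapT => na.
have := mle a (introT (asboolP _) na).
by rewrite Order.TotalTheory.leNgt am.
Qed.

Theorem corollary5p3 (d : Order.disp_t) (W : orderType d)
    (hW : continuum_succ_order W) (F : set_system nat) (hF : FU_filter F) :
  exists Fam : W -> set_system nat,
    [/\ forall a : W, FU_filter (Fam a),
        forall a : W, RK_le F (Fam a) &
        forall a b : W, (a < b)%O -> RK_lt (Fam a) (Fam b)].
Proof.
have [/well_order_well_founded wf _ small] := hW.
pose good (b : W) (prev : forall a, (a < b)%O -> set_system nat) H :=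
  [/\ FU_filter H, RK_le F H & forall a ab, RK_lt (prev a ab) H].
pose Fam := Fix wf (fun=> set_system nat) (fun b prev => xget F (good b prev)).
(* The default [F] of [xget] is never a fallback: [FamP] finds a good filter at each stage. *)
have FamE b : Fam b = xget F (good b (fun a _ => Fam a)).
  rewrite /Fam Fix_eq// => x f g fg; congr (xget _ (good _ _)).
  apply: functional_extensionality_dep => a.
  by apply: functional_extensionality_dep => ab.
have FamP b : good b (fun a _ => Fam a) (Fam b).
  elim/(well_founded_ind wf): b => b IH; rewrite FamE.
  apply: (@xgetPex _ F (good b (fun a _ => Fam a))).
  have [|H HP] := FU_strict_upper_bound (G := Fam) (small b) hF.
    by move=> a /IH[].
  by exists H.
exists Fam; split=> [a|a|a b ab].
- by have [] := FamP a.
- by have [] := FamP a.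
- by have [_ _] := FamP b; exact.
Qed.
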